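(* Let $n \geq 1$ and $r \geq 0$ be integers. Then, in $\mathbb{Q}[S_n]$, $$M_n^r = \sum_{\lambda:\ |\lambda| \leq n} \left[ \frac{r!}{(|\lambda|+1)!} \left( \prod_i \lambda_i \right) [t^{\,r-(|\lambda|+\ell(\lambda))}]\, f(t)^{|\lambda|} \prod_i f(\lambda_i t) \right] a_{\lambda;n},$$ where the sum runs over all integer partitions $\lambda$ (including the empty one) with $|\lambda| \leq n$.
   Context: For a partition $\lambda=(\lambda_1,\ldots,\lambda_\ell)$, $|\lambda|$ is its size, $\ell(\lambda)=\ell$ its number of parts, and $m_1(\lambda)$ its number of parts equal to $1$. For $\mu \vdash n$, $C_\mu \in \mathbb{Q}[S_n]$ denotes the formal sum of all permutations of cycle type $\mu$. For $|\lambda| \leq n$, set $a_{\lambda;n} = \binom{n-|\lambda|+m_1(\lambda)}{m_1(\lambda)} C_{\lambda 1^{n-|\lambda|}}$, where $\lambda 1^{n-|\lambda|}$ is the partition of $n$ obtained by adding $n-|\lambda|$ parts equal to $1$ to $\lambda$. Let $X_{n+1} = (1\ n+1) + (2\ n+1) + \cdots + (n\ n+1) \in \mathbb{Q}[S_{n+1}]$ be the $(n+1)$-th Jucys–Murphy element, and let $\mathbb{E}:\mathbb{Q}[S_{n+1}] \to \mathbb{Q}[S_n]$ be the linear map with $\mathbb{E}(\sigma) = \sigma|_{\{1,\ldots,n\}}$ if $\sigma(n+1)=n+1$ and $\mathbb{E}(\sigma)=0$ otherwise. Define $M_n^r = \mathbb{E}(X_{n+1}^r)$. Let $f(t) = 2t^{-1}\sinh(t/2)$,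 a power series in $t$, and $[t^k]$ denotes the coefficient of $t^k$ (zero if $k<0$). *)

(* Defs.v *)
From HB Require Import structures.
From mathcomp Require Import all_boot all_order all_fingroup all_algebra.
Set Implicit Arguments. Unset Strict Implicit. Unset Printing Implicit Defensive.
Import GRing.Theory.
Local Open Scope ring_scope.

(* A separate constant, because {ffun gT -> R} already carries the pointwise
   product. *)
Definition group_alg (R : comNzRingType) (gT : finGroupType) : Type :=
  {ffun gT -> R^o}.

HB.instance Definition _ (R : comNzRingType) (gT : finGroupType) :=
  GRing.Lmodule.copy (group_alg R gT) {ffun gT -> R^o}.

Section GroupAlgebra.
Variables (R : comNzRingType) (gT : finGroupType).
Implicit Types x y z : group_alg R gT.

Definition galg_coef x (g : gT) : R := (x : {ffun gT -> R^o}) g.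

Definition galg_elt (g : gT) : group_alg R gT :=
  [ffun h : gT => (h == g)%:R : R^o].

Definition galg_mul x y : group_alg R gT :=
  [ffun g : gT => \sum_(h : gT) galg_coef x h * galg_coef y (h^-1 * g)%g : R^o].

Fact galg_mulA : associative galg_mul.
Proof.
move=> x y z; apply/ffunP=> g; rewrite !ffunE.
transitivity (\sum_(h : gT) \sum_(k : gT)
    galg_coef x h * galg_coef y (h^-1 * k)%g * galg_coef z (k^-1 * g)%g).
  apply: eq_bigr => h _; rewrite /galg_coef ffunE mulr_sumr.
  rewrite (reindex_inj (mulgI h^-1%g)) /=; apply: eq_bigr => k _.
  by rewrite mulrA invMg invgK -!mulgA mulKVg.
rewrite exchange_big; apply: eq_bigr => k _ /=.
by rewrite /galg_coef ffunE mulr_suml.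
Qed.

Fact galg_mul1l : left_id (galg_elt 1%g) galg_mul.
Proof.
move=> x; apply/ffunP=> g; rewrite !ffunE (bigD1 1%g) //= big1 => [|h h1].
  by rewrite addr0 /galg_coef ffunE eqxx mul1r invg1 mul1g.
by rewrite /galg_coef ffunE (negPf h1) mul0r.
Qed.

Fact galg_mul1r : right_id (galg_elt 1%g) galg_mul.
Proof.
move=> x; apply/ffunP=> g; rewrite !ffunE (bigD1 g) //= big1 => [|h hg].
  by rewrite addr0 /galg_coef ffunE mulVg eqxx mulr1.
by rewrite /galg_coef ffunE -eq_mulVg1 (negPf hg) mulr0.
Qed.

Fact galg_mulDl : left_distributive galg_mul +%R.
Proof.
move=> x y z; apply/ffunP=> g; rewrite !ffunE -big_split /=.
by apply: eq_bigr => h _; rewrite /galg_coef ffunE mulrDl.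
Qed.

Fact galg_mulDr : right_distributive galg_mul +%R.
Proof.
move=> x y z; apply/ffunP=> g; rewrite !ffunE -big_split /=.
by apply: eq_bigr => h _; rewrite /galg_coef ffunE mulrDr.
Qed.

Fact galg_1_neq0 : galg_elt 1%g != 0.
Proof. by apply/eqP=> /ffunP/(_ 1%g)/eqP; rewrite !ffunE eqxx oner_eq0. Qed.

HB.instance Definition _ := GRing.Zmodule_isNzRing.Build (group_alg R gT)
  galg_mulA galg_mul1l galg_mul1r galg_mulDl galg_mulDr galg_1_neq0.

Fact galg_scaleAl (a : R) x y : a *: (x * y) = (a *: x) * y.
Proof.
apply/ffunP=> g; rewrite !ffunE scaler_sumr.
by apply: eq_bigr => h _; rewrite /galg_coef ffunE; exact: mulrA.
Qed.

HB.instance Definition _ :=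
  GRing.Lmodule_isLalgebra.Build R (group_alg R gT) galg_scaleAl.

Fact galg_scaleAr (a : R) x y : a *: (x * y) = x * (a *: y).
Proof.
apply/ffunP=> g; rewrite !ffunE scaler_sumr.
by apply: eq_bigr => h _; rewrite /galg_coef ffunE; exact: mulrCA.
Qed.

HB.instance Definition _ :=
  GRing.Lalgebra_isAlgebra.Build R (group_alg R gT) galg_scaleAr.

Lemma galg_eltM (g h : gT) : galg_elt (g * h)%g = galg_elt g * galg_elt h.
Proof.
apply/ffunP=> k; rewrite !ffunE (bigD1 g) //= big1 => [|l lg].
  rewrite addr0 /galg_coef !ffunE eqxx mul1r.
  by rewrite -(inj_eq (mulgI g^-1%g)) mulKg.
by rewrite /galg_coef ffunE (negPf lg) mul0r.
Qed.

Lemma galg_decomp x : x = \sum_(g : gT) galg_coef x g *: galg_elt g.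
Proof.
apply/ffunP=> h; rewrite sum_ffunE (bigD1 h) //= big1 => [|g gh].
  by rewrite addr0 !ffunE eqxx [RHS]mulr1.
by rewrite !ffunE eq_sym (negPf gh) scaler0.
Qed.

End GroupAlgebra.

(* Q[S_n], with S_n acting on 'I_n = {0, .., n-1}: the point n+1 of the usual
   1-based convention is ord_max : 'I_n.+1.  MathComp composes permutations
   from left to right. *)
Notation "'QS_ n" := (group_alg rat 'S_n)
  (at level 8, n at level 2, format "''QS_' n").

Definition is_partition (la : seq nat) : bool :=
  sorted geq la && (0%N \notin la).

(* A partition of size at most n has at most n parts, all of them at most n. *)
Definition partitions_leq (n : nat) : seq (seq nat) :=
  [seq la <- [seq map val (val b) | b : n.-bseq 'I_n.+1]
     | is_partition la && (sumn la <= n)%N].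

Lemma partitions_leq_uniq n : uniq (partitions_leq n).
Proof.
apply/filter_uniq; rewrite map_inj_uniq ?enum_uniq //.
by move=> b c /(inj_map val_inj)/val_inj.
Qed.

Lemma mem_partitions_leq n la :
  (la \in partitions_leq n) = is_partition la && (sumn la <= n)%N.
Proof.
rewrite mem_filter; case: (boolP (is_partition la && _)) => //=.
move=> /andP[/andP[_ la0] la_n].
have size_sumn s : 0%N \notin s -> (size s <= sumn s)%N.
  elim: s => //= a s IH; rewrite inE negb_or => /andP[a0 /IH sz].
  by rewrite -add1n leq_add // lt0n eq_sym.
have mem_sumn s a : a \in s -> (a <= sumn s)%N.
  elim: s => //= b s IH; rewrite inE => /predU1P[->|/IH sz]; first exact: leq_addr.
  exact: leq_trans sz (leq_addl _ _).
have szb : (size (map (@inord n) la) <= n)%N.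
  by rewrite size_map; apply: leq_trans (size_sumn _ la0) la_n.
apply/mapP; exists (Bseq szb); first by rewrite mem_enum.
rewrite /= -map_comp -[LHS]map_id; apply/eq_in_map => a a_la /=.
by rewrite inordK // ltnS (leq_trans (mem_sumn _ _ a_la)).
Qed.

(* porbits s also contains the singleton orbits of the fixed points. *)
Definition cycle_type n (s : 'S_n) : seq nat :=
  sort geq [seq #|c| | c : {set 'I_n} in porbits s].

Definition class_sum n (mu : seq nat) : 'QS_n :=
  \sum_(s : 'S_n | cycle_type s == mu) galg_elt rat s.

Definition a_elt (la : seq nat) n : 'QS_n :=
  let m1 := count_mem 1%N la in
  'C(n - sumn la + m1, m1)%:R *: class_sum n (la ++ nseq (n - sumn la) 1%N).

Definition jucys_murphy n : 'QS_n.+1 :=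
  \sum_(i < n) galg_elt rat (tperm (lift ord_max i) ord_max).

(* Only meaningful when s fixes ord_max; otherwise the value may be the
   default 1. *)
Definition perm_restr n (s : 'S_n.+1) : 'S_n :=
  insubd (1%g : 'S_n)
    [ffun i : 'I_n => odflt i (unlift ord_max (s (lift ord_max i)))].

Lemma perm_restrE n (s : 'S_n.+1) (i : 'I_n) : s ord_max = ord_max ->
  lift ord_max (perm_restr s i) = s (lift ord_max i).
Proof.
move=> s_max.
have E j : lift ord_max (odflt j (unlift ord_max (s (lift ord_max j))))
             = s (lift ord_max j).
  case: unliftP => [k -> //|]; rewrite -[in RHS]s_max => /perm_inj/eqP.
  by rewrite eq_sym (negPf (neq_lift _ _)).
rewrite /perm_restr -pvalE insubdK ?ffunE ?E //.
apply/injectiveP=> j k; rewrite !ffunE => /(congr1 (lift ord_max)).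
by rewrite !E => /perm_inj/lift_inj.
Qed.

Definition cond_exp n (x : 'QS_n.+1) : 'QS_n :=
  \sum_(s : 'S_n.+1 | s ord_max == ord_max)
    galg_coef x s *: galg_elt rat (perm_restr s).

Definition jm_moment n r : 'QS_n := cond_exp (jucys_murphy n ^+ r).

Definition pseries := nat -> rat.

Definition ps_one : pseries := fun k => (k == 0%N)%:R.

Definition ps_mul (u v : pseries) : pseries :=
  fun k => \sum_(i < k.+1) u i * v (k - i)%N.

Definition ps_exp (u : pseries) (m : nat) : pseries := iter m (ps_mul u) ps_one.

(* u(t) |-> u(c t) *)
Definition ps_dilate (c : rat) (u : pseries) : pseries := fun k => c ^+ k * u k.

(* [t^k] u for an integer k *)
Definition ps_coef (k : int) (u : pseries) : rat :=
  if k is Posz m then u m else 0.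

(* sinh t = (e^t - e^(-t)) / 2 *)
Definition ps_sinh : pseries := fun k => (1 - (-1) ^+ k) / (2 * k`!%:R).

(* f(t) = 2 t^(-1) sinh (t / 2); the shift k.+1 is the division by t, exact
   since sinh has no constant term. *)
Definition ps_f : pseries := fun k => 2 * ps_dilate (1 / 2) ps_sinh k.+1.

(* Main.v *)
Require Import Defs.
From HB Require Import structures.
From mathcomp Require Import all_boot all_order all_fingroup all_algebra.
From mathcomp Require Import ring zify.
Set Implicit Arguments. Unset Strict Implicit. Unset Printing Implicit Defensive.
Import GRing.Theory.
Local Open Scope ring_scope.

(** Write [z] for the point [n+1].  The coefficient of [s] in [X_(n+1)^r] counts
    the words of [r] star transpositions [(i z)] with product [s]; sort these
    words by the set [A] made of [z] and of the letters that occur.  The claim,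
    proved by induction on [r], is that for fixed [A] the exponential generating
    function in [r] of the counts is
      [x^(-d) P(x)]  at  [x = e^t],  where
      [P(x) = (x - 1)^(d-1) chi(x) / (d+1)!],  [d = #|A| - 1],
    and [chi] is the characteristic polynomial of [s] acting on [A].
    Removing one letter of the word turns the claim into an identity between
    [x P' - d P], the polynomials [P] of the permutations [(i z) s], and the [P]
    of the permutation obtained by deleting [s z] from its cycle.  Since
    [(i z) s] changes the matrix [x - s] by a rank one matrix, its determinant
    is expressed by the adjugate [G] of [x - s]; the identity then follows from
    Jacobi's formula for [chi'], from the row and column sums of [G], and from
    [chi = (x - 1) G z z + chi_-], where [chi_-] belongs to the deletion.
    Finally [chi] is the product of the [x^p - 1] over the cycle lengths [p],
    and [x^(-p/2) (x^p - 1) = 2 sinh (p t / 2) = p t f(p t)]. *)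

(** * Determinants *)

(** The matrix with blocks [1], [- v], [u], [M] is brought to triangular form in two ways;
    eliminating with the corner [1] yields [\det (M + u *m v)]. *)
Lemma det_rank1D (R : idomainType) n (M : 'M[R]_n) (u : 'cV_n) (v : 'rV_n) :
  \det M != 0 -> \det (M + u *m v) = \det M + (v *m \adj M *m u) 0 0.
Proof.
move=> M0.
have E1 : \det (block_mx 1%:M (- v) u M) = \det (M + u *m v).
  have -> : block_mx 1%:M (- v) u M
      = block_mx (1%:M : 'M_1) 0 u 1%:M *m block_mx 1%:M (- v) 0 (M + u *m v).
    rewrite mulmx_block ?mul1mx ?mul0mx ?mulmx1 ?mulmx0 ?addr0 mulmxN.
    by rewrite addrCA addNr addr0.
  by rewrite det_mulmx det_lblock det_ublock !det1 !mul1r.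
(* The right factor introduced next has determinant [\det M] and clears the lower left block, so
   that both sides carry a factor [\det M]. *)
apply: (mulIf M0); rewrite -E1.
transitivity (\det (block_mx 1%:M (- v) u M *m
                block_mx ((\det M)%:M : 'M_1) 0 (- (\adj M *m u)) 1%:M)).
  by rewrite det_mulmx det_lblock det1 mulr1 det_scalar1.
rewrite mulmx_block ?mul1mx ?mulmx0 ?mulmx1 ?add0r mulmxN mulNmx opprK.
rewrite mulmxN (mulmxA M) mul_mx_adj mul_scalar_mx mul_mx_scalar subrr.
rewrite det_ublock; congr (_ * _).
by rewrite det_mx11 mxE mxE eqxx mulr1n mulmxA.
Qed.

Lemma deriv_prod (R : comNzRingType) (I : finType) (F : I -> {poly R}) :
  (\prod_i F i)^`() = \sum_i (F i)^`() * \prod_(j | j != i) F j.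
Proof.
suff H (r : seq I) : uniq r -> (\prod_(i <- r) F i)^`()
    = \sum_(i <- r) (F i)^`() * \prod_(j <- r | j != i) F j.
  by apply: H; apply: index_enum_uniq.
elim: r => [|a r IH] /=; first by rewrite !big_nil derivC.
case/andP=> ar ur; rewrite !big_cons derivM IH // eqxx /=.
congr (_ * _ + _).
  rewrite big_seq [RHS]big_seq_cond; apply: eq_bigl => j.
  by case: eqVneq => [->|]; rewrite ?andbT // (negPf ar).
rewrite mulr_sumr; apply: eq_big_seq => i ir.
rewrite big_cons ifT; first by rewrite mulrCA.
by apply: contraNneq ar => ->.
Qed.

Lemma deriv_det (R : comNzRingType) n (M : 'M[{poly R}]_n) :
  (\det M)^`() = \sum_i \sum_j (M i j)^`() * \adj M j i.
Proof.
have E i : \sum_j (M i j)^`() * \adj M j i =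
    \sum_(t : 'S_n) (-1) ^+ t * ((M i (t i))^`() * \prod_(j | j != i) M j (t j)).
  (* [N] is [M] with row [i] differentiated: Laplace expansion along that row gives one side, the
     Leibniz formula the other. Summing over [i] is Jacobi's formula. *)
  pose N := \matrix_(k, j) if k == i then (M k j)^`() else M k j.
  transitivity (\det N).
    rewrite (expand_det_row _ i); apply: eq_bigr => j _.
    rewrite !mxE eqxx; congr (_ * _).
    rewrite /cofactor; congr (_ * \det _); apply/matrixP => k l.
    by rewrite !mxE eq_sym (negPf (neq_lift _ _)).
  apply: eq_bigr => t _; congr (_ * _).
  rewrite (bigD1 i) //= mxE eqxx; congr (_ * _).
  by apply: eq_bigr => j /negPf ji; rewrite mxE ji.
under eq_bigr do rewrite E.
rewrite exchange_big raddf_sum; apply: eq_bigr => t _ /=.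
rewrite -mulr_sumr -deriv_prod.
by case: (odd_perm t); rewrite ?expr1 ?expr0 ?mul1r // !mulN1r derivN.
Qed.

(** * The characteristic polynomial of a permutation *)

Lemma polyX1_neq0 : 'X - 1 != 0 :> {poly rat}.
Proof. by have := monic_neq0 (monicXsubC (1 : rat)). Qed.

(* [x - s] on [A] and the identity outside [A]; rows act by [i |-> s i]. *)
Definition cyc_mx n (A : {set 'I_n}) (s : 'S_n) : 'M[{poly rat}]_n :=
  \matrix_(i, j) if i \in A then 'X *+ (i == j) - (s i == j)%:R
                 else (i == j)%:R.

Definition cyc_det n (A : {set 'I_n}) (s : 'S_n) := \det (cyc_mx A s).

Definition perm_stable n (A : {set 'I_n}) (s : 'S_n) :=
  forall i, (s i \in A) = (i \in A).

Section CycMatrix.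
Variables (n : nat) (s : 'S_n).
Implicit Types (A B C : {set 'I_n}) (i j : 'I_n).

Lemma cyc_mx_rowE A m (M : 'M_(n, m)) i (j : 'I_m) : i \in A ->
  (cyc_mx A s *m M) i j = 'X * M i j - M (s i) j.
Proof.
move=> iA; rewrite mxE.
transitivity (\sum_k ((if k == i then 'X * M k j else 0)
                     - if k == s i then M k j else 0)).
  apply: eq_bigr => k _; rewrite mxE iA (eq_sym i) (eq_sym (s i)) mulrBl.
  by case: (k == i); case: (k == s i); rewrite ?mulr0n ?mulr1n ?mul0r ?mul1r.
by rewrite sumrB -!big_mkcond !big_pred1_eq.
Qed.

Lemma cyc_mx_rowNE A m (M : 'M_(n, m)) i (j : 'I_m) : i \notin A ->
  (cyc_mx A s *m M) i j = M i j.
Proof.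
move=> /negPf iA; rewrite mxE.
rewrite (bigD1 i) //= mxE iA eqxx mul1r big1 ?addr0 // => k ki.
by rewrite mxE iA eq_sym (negPf ki) mul0r.
Qed.

Lemma cyc_mx_colE A m (M : 'M_(m, n)) (i : 'I_m) j : perm_stable A s -> j \in A ->
  (M *m cyc_mx A s) i (s j) = 'X * M i (s j) - M i j.
Proof.
move=> sA jA; rewrite mxE.
transitivity (\sum_k ((if k == s j then 'X * M i k else 0)
                     - if k == j then M i k else 0)).
  apply: eq_bigr => k _; rewrite mxE (inj_eq perm_inj).
  case: ifP => kA.
    rewrite mulrBr.
    by case: (k == s j); case: (k == j);
      rewrite ?mulr0n ?mulr1n ?mulr0 ?mulr1 1?mulrC.
  have -> : (k == s j) = false.
    by apply: contraFF kA => /eqP->; rewrite sA.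
  have -> : (k == j) = false by apply: contraFF kA => /eqP->.
  by rewrite mulr0 subrr.
by rewrite sumrB -!big_mkcond !big_pred1_eq.
Qed.

(** For [i] in [A], both [i] and [s i] lie outside [B], so the rows of the second factor that enter
    row [i] of the product are rows of the identity. *)
Lemma cyc_mxU A B : perm_stable A s -> [disjoint A & B] ->
  cyc_mx (A :|: B) s = cyc_mx A s *m cyc_mx B s.
Proof.
move=> sA dAB; apply/matrixP => i j.
have [iA|iA] := boolP (i \in A).
  have nB k : k \in A -> k \in B = false.
    by move=> kA; rewrite (disjointFr dAB).
  rewrite cyc_mx_rowE // !mxE inE iA /= nB // nB ?sA //.
  by rewrite mulr_natr.
by rewrite cyc_mx_rowNE // !mxE inE (negPf iA).
Qed.

Lemma cyc_det0 : cyc_det set0 s = 1.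
Proof.
rewrite /cyc_det -(det1 _ n); congr (\det _); apply/matrixP => i j.
by rewrite !mxE inE.
Qed.

Lemma cyc_det_bigcup (r : seq {set 'I_n}) :
    (forall C, C \in r -> perm_stable C s) -> pairwise (fun C D => [disjoint C & D]) r ->
  cyc_det (\bigcup_(C <- r) C) s = \prod_(C <- r) cyc_det C s.
Proof.
elim: r => [|C r IH] st; first by rewrite !big_nil cyc_det0.
rewrite /= => /andP[dC dr]; rewrite !big_cons /cyc_det cyc_mxU.
- rewrite det_mulmx -/(cyc_det _ _) -/(cyc_det _ _) IH // => D Dr.
  by apply: st; rewrite inE Dr orbT.
- by apply: st; rewrite inE eqxx.
elim: r dC {IH st dr} => [|D r IH] /=;
  first by rewrite big_nil disjoint_sym disjoints_subset sub0set.
case/andP=> dD dr; rewrite big_cons disjoint_sym disjoints_subset subUset.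
rewrite -!disjoints_subset disjoint_sym dD /= disjoint_sym; exact: IH.
Qed.

Definition set_row A : 'rV[{poly rat}]_n := \row_j (j \in A)%:R.

Lemma sum_mem (R : pzRingType) A (F : 'I_n -> R) :
  \sum_j (j \in A)%:R * F j = \sum_(j in A) F j.
Proof. by rewrite [RHS]big_mkcond; apply: eq_bigr => j _;
  rewrite mulr_natl mulrb. Qed.

Lemma cyc_mx_row_sum A : perm_stable A s ->
  cyc_mx A s *m (set_row A)^T = ('X - 1) *: (set_row A)^T.
Proof.
move=> sA; apply/matrixP => i j; have [iA|iA] := boolP (i \in A).
  by rewrite cyc_mx_rowE // !mxE sA iA mulrBl mul1r.
by rewrite cyc_mx_rowNE // !mxE (negPf iA) mulr0.
Qed.

Lemma cyc_mx_col_sum A : perm_stable A s ->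
  set_row A *m cyc_mx A s = ('X - 1) *: set_row A.
Proof.
move=> sA; apply/matrixP => i k; rewrite -[k](permKV s).
set j := (s^-1)%g k; have [jA|jA] := boolP (j \in A).
  by rewrite cyc_mx_colE // !mxE sA jA mulrBl mul1r.
rewrite !mxE sA (negPf jA) mulr0 big1 // => l _.
rewrite !mxE; case: (boolP (l \in A)) => lA; rewrite ?mul0r // mul1r.
case: eqP => [El|_]; first by rewrite El sA (negPf jA) in lA.
case: eqP => [/perm_inj El|_]; first by rewrite El (negPf jA) in lA.
by rewrite subrr.
Qed.

(** Since [s] permutes [A], the indicator vector of [A] is an eigenvector of [cyc_mx A s] for
    ['X - 1]. Multiplying by the adjugate turns the matrix into the scalar [cyc_det A s]. *)
Lemma adj_row_sum A i : perm_stable A s -> i \in A ->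
  ('X - 1) * \sum_(j in A) \adj (cyc_mx A s) i j = cyc_det A s.
Proof.
move=> sA iA; have /matrixP/(_ i 0) := congr1 (mulmx (\adj (cyc_mx A s))) (cyc_mx_row_sum sA).
rewrite mulmxA mul_adj_mx mul_scalar_mx -scalemxAr !mxE iA mulr1 /cyc_det => ->.
congr (_ * _); rewrite -sum_mem; apply: eq_bigr => j _; by rewrite !mxE mulrC.
Qed.

Lemma adj_col_sum A j : perm_stable A s -> j \in A ->
  ('X - 1) * \sum_(i in A) \adj (cyc_mx A s) i j = cyc_det A s.
Proof.
move=> sA jA; have /matrixP/(_ 0 j) := congr1 (mulmx^~ (\adj (cyc_mx A s))) (cyc_mx_col_sum sA).
rewrite -mulmxA mul_mx_adj mul_mx_scalar -scalemxAl !mxE jA mulr1 /cyc_det => ->.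
congr (_ * _); rewrite -sum_mem; apply: eq_bigr => i _; by rewrite !mxE.
Qed.

Lemma porbit_stable a : perm_stable (porbit s a) s.
Proof.
move=> i; rewrite -!eq_porbit_mem.
by have := porbit_perm s 1 i; rewrite expg1 => ->.
Qed.

(* On a nontrivial cycle, a nonzero term of the Leibniz formula that uses one
   diagonal entry uses all of them, so the other terms do not involve ['X]. *)
Lemma cyc_det_leibniz_const a (t : 'S_n) : s a != a -> t != 1%g ->
  exists c, \prod_i cyc_mx (porbit s a) s i (t i) = c%:P.
Proof.
move=> sa t1; set C := porbit s a.
have sC i : i \in C -> s i != i.
  case/porbitP=> k ->; rewrite -permM -expgSr expgS permM.
  by rewrite (inj_eq perm_inj).
have [/existsP[i Wi0]|/existsPn W0] := boolP [exists i, cyc_mx C s i (t i) == 0].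
  by exists 0; rewrite (bigD1 i) //= (eqP Wi0) mul0r.
have tC i : i \in C -> t i = i \/ t i = s i.
  move=> iC; have := W0 i; rewrite mxE iC.
  case: (i =P t i) => [<-|_]; first by left.
  by case: (s i =P t i) => [<-|_]; [right|rewrite subrr eqxx].
have tN i : i \notin C -> t i = i.
  move=> iC; have := W0 i; rewrite mxE (negPf iC).
  by case: (i =P t i) => [<-|]; rewrite ?eqxx.
(* If [t] fixes [j = s l], then [t l = s l] would give [t l = t j] with [l != j]. So a fixed point
   in [C] spreads backwards around the whole cycle and forces [t = 1]. *)
have NC i : i \in C -> t i != i.
  move=> iC; apply: contraNneq t1 => ti; apply/eqP/permP => j; rewrite perm1.
  have [jC|/tN //] := boolP (j \in C).
  have : j \in porbit (s^-1)%g i.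
    by rewrite porbitV; move: iC jC; rewrite -!eq_porbit_mem => /eqP-> .
  case/porbitP=> k ->; elim: k {j jC} => [|k IH]; first by rewrite expg0 perm1.
  set j := (s^-1 ^+ k)%g i in IH *.
  rewrite expgSr permM -/j; set l := (s^-1)%g j.
  have jl : j = s l by rewrite permKV.
  have jC : j \in C.
    rewrite -eq_porbit_mem -(porbitV s j) porbit_perm porbitV.
    by rewrite eq_porbit_mem.
  have lC : l \in C by rewrite -(porbit_stable a) -jl.
  case: (tC l lC) => // tl.
  by move: (sC l lC); rewrite -jl -(inj_eq (@perm_inj _ t)) IH tl -jl eqxx.
exists (\prod_i (if i \in C then - 1 else 1)).
rewrite rmorph_prod; apply: eq_bigr => i _ /=; rewrite mxE.
have [iC|iC] := boolP (i \in C).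
  case: (tC i iC) => [/eqP|]; first by rewrite (negPf (NC i iC)).
  by move=> <-; rewrite eq_sym (negPf (NC i iC)) mulr0n eqxx sub0r polyCN.
by rewrite tN // eqxx.
Qed.

Lemma porbit_fixed a : s a = a -> porbit s a = [set a].
Proof.
move=> sa; apply/setP => i; rewrite inE; apply/porbitP/eqP => [[k ->]|->].
  by elim: k => [|k IH]; rewrite ?expg0 ?perm1 // expgS permM sa.
by exists 0; rewrite expg0 perm1.
Qed.

(** When [s] moves [a], the identity term of the Leibniz formula is ['X^#|C|] and all other terms
    are constants. A fixed point is treated apart, since its diagonal entry is already ['X - 1]. *)
Lemma cyc_det_porbit a : cyc_det (porbit s a) s = 'X^#|porbit s a| - 1.
Proof.
set C := porbit s a.
have [c Dc] : exists c, cyc_det C s = 'X^#|C| + c%:P.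
  have [sa|sa] := eqVneq (s a) a.
    exists (-1); rewrite /C porbit_fixed // cards1 expr1 polyCN /cyc_det.
    rewrite det_trig; last first.
      apply/is_trig_mxP => i j ij; rewrite mxE inE.
      have nij : i == j = false by apply: contraTF ij => /eqP->; rewrite ltnn.
      by case: eqP => [Ei|]; rewrite nij // Ei sa -Ei nij mulr0n subrr.
    rewrite (bigD1 a) //= mxE inE eqxx sa eqxx mulr1n big1 ?mulr1 // => i ia.
    by rewrite mxE inE (negPf ia) eqxx.
  pose T t := (-1) ^+ (t : 'S_n) * \prod_i cyc_mx C s i (t i).
  have [c Dc] : exists c, \sum_(t | t != 1%g) T t = c%:P.
    apply: (big_ind (fun p => exists c, p = c%:P)).
    - by exists 0.
    - by move=> p q [c ->] [d ->]; exists (c + d); rewrite polyCD.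
    - move=> t t1; have [c Dc] := cyc_det_leibniz_const sa t1.
      by exists ((-1) ^+ t * c); rewrite /T Dc polyCM rmorphXn /= polyCN.
  exists c; rewrite -Dc /cyc_det /determinant (bigD1 1%g) //=; congr (_ + _).
  rewrite odd_perm1 expr0 mul1r.
  rewrite (bigID (mem C)) /= [X in _ * X]big1 ?mulr1 => [|i /negPf iC];
    last first.
    by rewrite mxE iC perm1 eqxx.
  rewrite (eq_bigr (fun=> 'X)) ?prodr_const // => i iC.
  rewrite mxE iC perm1 eqxx.
  have /negPf-> : s i != i; last by rewrite subr0.
  case/porbitP: iC => k ->; rewrite -permM -expgSr expgS permM.
  by rewrite (inj_eq perm_inj).
(* the constant is determined by the root [1] *)
have /(congr1 (fun p => p.[1])) := adj_row_sum (porbit_stable a) (porbit_id s a).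
rewrite -/C Dc hornerM hornerD hornerX hornerN hornerC subrr mul0r.
rewrite hornerD hornerXn hornerC expr1n => /esym/eqP.
by rewrite addrC addr_eq0 => /eqP->; rewrite polyCN.
Qed.

End CycMatrix.

(** * Transpositions, deletion from a cycle, and the adjugate *)

Section CycDet.
Variables (n : nat).
Implicit Types (s : 'S_n) (A B C : {set 'I_n}) (i j : 'I_n).

Lemma porbits_disjoint s C D : C \in porbits s -> D \in porbits s -> C != D ->
  [disjoint C & D].
Proof.
case/imsetP=> x _ -> /imsetP[y _ ->] xy; rewrite -setI_eq0; apply: contraNT xy.
case/set0Pn=> k; rewrite inE => /andP[]; rewrite -!eq_porbit_mem.
by move=> /eqP<-.
Qed.

Lemma bigcup_porbits s A : perm_stable A s ->
  \bigcup_(C <- [seq C : {set 'I_n} <- enum (porbits s) | C \subset A]) C = A.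
Proof.
move=> sA; rewrite big_filter big_enum_cond /=; apply/setP => i.
apply/bigcupP/idP => [[C /andP[_ /subsetP CA]]|iA]; first exact: CA.
exists (porbit s i); last exact: porbit_id.
rewrite imset_f //; apply/subsetP => j /porbitP[k ->].
by elim: k => [|k IH]; rewrite ?expg0 ?perm1 // expgSr permM sA.
Qed.

Lemma cyc_det_prod s A : perm_stable A s ->
  cyc_det A s = \prod_(C in porbits s | C \subset A) ('X^#|C| - 1).
Proof.
move=> sA; rewrite -[in LHS](bigcup_porbits sA) cyc_det_bigcup.
- rewrite big_filter big_enum_cond /=; apply: eq_bigr => C /andP[].
  by case/imsetP=> a _ -> _; rewrite cyc_det_porbit.
- move=> C; rewrite mem_filter mem_enum => /andP[_ /imsetP[a _ ->]].
  exact: porbit_stable.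
have : uniq [seq C : {set 'I_n} <- enum (porbits s) | C \subset A].
  by rewrite filter_uniq ?enum_uniq.
rewrite uniq_pairwise; apply: (@sub_in_pairwise _ (mem (porbits s))).
  by move=> C D CP DP CD; apply: porbits_disjoint CP DP CD.
by apply/allP => C; rewrite mem_filter mem_enum => /andP[].
Qed.

Lemma cyc_det_neq0 s A : perm_stable A s -> cyc_det A s != 0.
Proof.
move=> sA; rewrite cyc_det_prod //;
  apply/prodf_neq0 => C /andP[/imsetP[a _ ->] _].
by rewrite monic_neq0 // monicXnsubC // lt0n card_porbit_neq0.
Qed.

Lemma cyc_det_fixed s A i : i \in A -> s i = i ->
  cyc_det A s = ('X - 1) * cyc_det (A :\ i) s.
Proof.
move=> iA si; rewrite /cyc_det -[in LHS](setD1K iA) cyc_mxU.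
- rewrite det_mulmx -/(cyc_det [set i] s) -(porbit_fixed si) cyc_det_porbit.
  by rewrite porbit_fixed // cards1 expr1.
- move=> j; rewrite !inE; apply/eqP/eqP => [|->//].
  by rewrite -{1}si => /perm_inj.
by rewrite disjoints_subset sub1set !inE eqxx.
Qed.

Lemma perm_stable_tperm s A i z : perm_stable A s -> i \in A -> z \in A ->
  perm_stable A (tperm i z * s)%g.
Proof.
by move=> sA iA zA j; rewrite permM sA; case: tpermP => [->|->|];
  rewrite ?iA ?zA.
Qed.

Lemma perm_stableD1 s A i : perm_stable A s -> s i = i -> perm_stable (A :\ i) s.
Proof. by move=> sA si j; rewrite !inE sA -{1}si (inj_eq perm_inj). Qed.

Section Adjugate.
Variables (s : 'S_n) (A : {set 'I_n}) (z : 'I_n).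
Hypotheses (sA : perm_stable A s) (zA : z \in A).

Local Notation chi := (cyc_det A s).
Local Notation G := (\adj (cyc_mx A s)).

(** This is row [i] of [cyc_mx A s *m G = chi]; it moves a row index of [G] along [s]. *)
Lemma adj_permE i j : i \in A -> G (s i) j = 'X * G i j - chi *+ (i == j).
Proof.
move=> iA; have := cyc_mx_rowE s G j iA.
by rewrite mul_mx_adj !mxE -/chi => ->; rewrite opprB addrC subrK.
Qed.

Lemma adj_perm_colE i j : j \in A -> G i j = 'X * G i (s j) - chi *+ (i == s j).
Proof.
move=> jA; have := cyc_mx_colE G i sA jA.
by rewrite mul_adj_mx !mxE -/chi => ->; rewrite opprB addrC subrK.
Qed.

(** The product [tperm i z * s] exchanges the images of [i] and [z], which is a rank one change of
    the matrix. [det_rank1D] produces entries of [G] in rows [s i] and [s z]; [adj_permE] brings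
    them back to rows [i] and [z]. *)
Lemma cyc_det_tperm i : i \in A -> i != z ->
  cyc_det A (tperm i z * s) = - chi + 'X * (G i i + G z z - G i z - G z i).
Proof.
move=> iA iz.
have -> : cyc_det A (tperm i z * s) = \det (cyc_mx A s +
    (delta_mx i 0 - delta_mx z 0 : 'cV_n) *m (delta_mx 0 (s i) - delta_mx 0 (s z))).
  congr (\det _); apply/matrixP => k j.
  rewrite !mxE big_ord1 !mxE !eqxx !andbT /= !(eq_sym j) permM.
  case: (tpermP i z k) => [->|->|/eqP ki /eqP kz].
  - by rewrite iA eqxx (negPf iz) /= subr0 mul1r addrA subrK.
  - by rewrite zA eqxx (eq_sym z i) (negPf iz) /= sub0r mulN1r opprB addrA subrK.
  by rewrite (negPf ki) (negPf kz) /= subrr mul0r addr0.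
rewrite det_rank1D ?cyc_det_neq0 //.
rewrite mulmxBl -!rowE mulmxBr -!colE !mxE -/chi.
have := adj_permE i iA; have := adj_permE z iA.
have := adj_permE i zA; have := adj_permE z zA.
rewrite !mxE => -> -> -> ->; rewrite !eqxx (negPf iz) (eq_sym z) (negPf iz).
rewrite !mulr0n !mulr1n; ring.
Qed.

(** In Jacobi's formula only the diagonal entries of the rows in [A] depend on ['X], each with
    derivative 1. *)
Lemma deriv_cyc_det : chi^`() = \sum_(i in A) G i i.
Proof.
rewrite /cyc_det deriv_det [RHS]big_mkcond; apply: eq_bigr => i _.
rewrite (bigD1 i) //= [X in _ + X]big1 ?addr0 => [|j ji].
  rewrite [cyc_mx A s i i]mxE; case: ifP => _; rewrite eqxx.
    by rewrite derivB derivX -polyC_natr derivC subr0 mul1r.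
  by rewrite derivC mul0r.
rewrite [cyc_mx A s i j]mxE; case: ifP => _; rewrite eq_sym (negPf ji).
  by rewrite sub0r derivN -polyC_natr derivC oppr0 mul0r.
by rewrite derivC mul0r.
Qed.

Lemma sum_cyc_det_tperm :
  ('X - 1) * \sum_(i in A | i != z) cyc_det A (tperm i z * s)
    = ('X - 1) * ('X * chi^`() - #|A|.-1%:R * chi + 'X * #|A|%:R * G z z)
      - 2 * 'X * chi.
Proof.
have r := adj_row_sum sA zA; have c := adj_col_sum sA zA.
rewrite (bigD1 z) //= in r; rewrite (bigD1 z) //= in c.
have t := deriv_cyc_det; rewrite (bigD1 z) //= in t.
rewrite (eq_bigr (fun i => - chi + 'X * (G i i + G z z - G i z - G z i)));
  last first.
  by move=> i /andP[iA iz]; apply: cyc_det_tperm.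
have cA : #|[pred i in A | i != z]| = #|A|.-1.
  by rewrite (cardsD1 z A) zA /=; apply: eq_card => i; rewrite !inE andbC.
rewrite big_split /= -mulr_sumr !sumrB big_split /= !sumr_const !cA.
have -> : \sum_(i in A | i != z) G i i = chi^`() - G z z by rewrite t addrAC subrr add0r.
have cA1 : #|A| = #|A|.-1.+1 by rewrite prednK // (cardD1 z) zA.
set d := #|A|.-1 in cA1 *;
  rewrite cA1 -(mulr_natl (- chi) d) -(mulr_natl (G z z) d) -natr1.
set R := \sum_(i in A | i != z) G z i in r *.
set C := \sum_(i in A | i != z) G i z in c *.
transitivity (('X - 1) * ('X * (chi^`() + d%:R * G z z + G z z) - d%:R * chi)
    - 'X * (('X - 1) * (G z z + R)) - 'X * (('X - 1) * (G z z + C)));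
        first by ring.
rewrite r c; ring.
Qed.

(** The permutation [tperm (s z) z * s] fixes [s z] and sends [z] to [s (s z)]: it deletes [s z]
    from its cycle. Take [i = s z] in [cyc_det_tperm], split off this fixed point, and reduce all
    entries of [G] to the single one at [z], [s z]. *)
Lemma cyc_det_contract : s z != z ->
  chi = ('X - 1) * G z z + cyc_det (A :\ s z) (tperm (s z) z * s).
Proof.
move=> sz; have szA : s z \in A by rewrite sA.
apply: (mulfI polyX1_neq0).
have := cyc_det_tperm szA sz;
  rewrite (@cyc_det_fixed (tperm (s z) z * s) A (s z)) //; last first.
  by rewrite permM tpermL.
rewrite !adj_permE // (adj_perm_colE z zA) eqxx [z == s z]eq_sym (negPf sz).
rewrite !mulr0n !mulr1n => E; rewrite [RHS]mulrDr E; ring.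
Qed.

Lemma cyc_det_adj_fixed : s z = z -> chi = ('X - 1) * G z z.
Proof.
move=> sz; have := adj_permE z zA; rewrite sz eqxx mulr1n => E.
by rewrite mulrBl mul1r {2}E opprB addrC subrK.
Qed.

End Adjugate.

(* The division is exact when [A] is nonempty and stable: see [cyc_quotK]. *)
Definition cyc_quot A s := cyc_det A s %/ ('X - 1).

Lemma cyc_quotK A s z : perm_stable A s -> z \in A ->
  cyc_det A s = ('X - 1) * cyc_quot A s.
Proof.
move=> sA zA; rewrite /cyc_quot -(adj_row_sum sA zA) mulKp ?polyX1_neq0 //.
Qed.

Lemma sum_cyc_quot_tperm A s z : perm_stable A s -> z \in A ->
  ('X - 1) * \sum_(i in A | i != z) cyc_quot A (tperm i z * s)
    + 'X * #|A|%:R * (if s z == z then 0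
                      else cyc_quot (A :\ s z) (tperm (s z) z * s))
  = ('X - 1) * ('X * (cyc_quot A s)^`() - #|A|.-1%:R * cyc_quot A s)
    + 'X * #|A|.-1%:R * cyc_quot A s.
Proof.
move=> sA zA.
have := sum_cyc_det_tperm sA zA; have K := cyc_quotK sA zA.
rewrite (eq_bigr (fun i => ('X - 1) * cyc_quot A (tperm i z * s))); last first.
  move=> i /andP[iA _]; apply: (cyc_quotK _ zA); exact: perm_stable_tperm.
rewrite -mulr_sumr K derivM derivB derivX -polyC1 derivC polyC1 subr0 mul1r.
set k := cyc_quot A s; set S := \sum_(i in A | _) _.
set G := \adj _ z z; set k' := if _ then _ else _ => E.
(* This is the deletion identity divided by ['X - 1]. It eliminates the adjugate entry, leaving only
   quotients. *)
have EG : k = G + k'.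
  apply: (mulfI polyX1_neq0); rewrite -K /k'; case: eqVneq => [sz|sz].
    by rewrite addr0 (cyc_det_adj_fixed zA sz).
  rewrite (cyc_det_contract sA zA sz) mulrDr; congr (_ + _).
  apply: (@cyc_quotK _ _ z); last by rewrite !inE eq_sym sz.
  apply: perm_stableD1; last by rewrite permM tpermL.
  by apply: perm_stable_tperm; rewrite ?sA.
have cA1 : #|A| = #|A|.-1.+1 by rewrite prednK // (cardD1 z) zA.
move: E; set d := #|A|.-1 in cA1 *; rewrite cA1 -natr1 => E.
have Ek' : k' = k - G by rewrite EG addrC addKr.
apply: (mulfI polyX1_neq0); rewrite [LHS]mulrDr E Ek'; ring.
Qed.
End CycDet.

(** * Star factorizations *)

Section MomentFunctional.
Variables (c : rat) (k : nat).
Implicit Type p : {poly rat}.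

(* [k!] times the coefficient of [t^k] in [x^(-c) p(x)] at [x = e^t]. *)
Definition expo_moment (p : {poly rat}) : rat :=
  \sum_(i < size p) p`_i * (i%:R - c) ^+ k.

Lemma expo_moment_wide m (p : {poly rat}) : (size p <= m)%N ->
  expo_moment p = \sum_(i < m) p`_i * (i%:R - c) ^+ k.
Proof.
move=> pm; rewrite /expo_moment (big_ord_widen m (fun i => p`_i * (i%:R - c) ^+ k)) //.
rewrite big_mkcond; apply: eq_bigr => i _; case: ltnP => // le_p_i.
by rewrite nth_default // mul0r.
Qed.

Fact expo_moment_is_linear : scalar expo_moment.
Proof.
move=> a p q; pose m := maxn (size p) (size q).
have [pm qm] : (size p <= m)%N /\ (size q <= m)%N by rewrite leq_maxl leq_maxr.
rewrite !(@expo_moment_wide m) //; last first.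
  apply: leq_trans (size_polyD _ _) _; rewrite geq_max qm andbT.
  exact: leq_trans (size_scale_leq _ _) pm.
rewrite mulr_sumr -big_split; apply: eq_bigr => i _ /=.
by rewrite coefD coefZ mulrDl -mulrA.
Qed.

HB.instance Definition _ :=
  GRing.isLinear.Build rat {poly rat} rat *%R expo_moment expo_moment_is_linear.

End MomentFunctional.

Lemma expo_moment0 c p : expo_moment c 0 p = p.[1].
Proof.
rewrite horner_coef; apply: eq_bigr => i _.
by rewrite expr0 expr1n.
Qed.

Lemma expo_momentMX c k p : expo_moment (c + 1) k ('X * p) = expo_moment c k p.
Proof.
have sz : (size ('X * p)%R <= (size p).+1)%N.
  by rewrite mulrC (leq_trans (size_polyMleq _ _)) // size_polyX addn2.
rewrite (expo_moment_wide _ _ sz) big_ord_recl coefXM mul0r add0r.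
apply: eq_bigr => i _; rewrite coefXM /= /bump add1n /= -natr1.
by rewrite opprD addrACA subrr addr0.
Qed.

Lemma expo_momentMXn c k m p :
  expo_moment (c + m%:R) k ('X^m * p) = expo_moment c k p.
Proof.
elim: m => [|m IH]; first by rewrite addr0 expr0 mul1r.
by rewrite -natr1 addrA exprS -mulrA expo_momentMX.
Qed.

(** At [x = e^t] one has [d/dt = x d/dx], and this sends [x^(-c) p] to [x^(-c) (x p' - c p)]. *)
Lemma expo_momentS c k p :
  expo_moment c k.+1 p = expo_moment c k ('X * p^`() - c *: p).
Proof.
have sz : (size ('X * p^`() - c *: p)%R <= size p)%N.
  rewrite (leq_trans (size_polyD _ _)) // geq_max size_polyN size_scale_leq.
  rewrite andbT; have [->|p0] := eqVneq p 0;
    first by rewrite linear0 mulr0 size_poly0.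
  by rewrite mulrC (leq_trans (size_polyMleq _ _)) // size_polyX addn2 /= lt_size_deriv.
rewrite (expo_moment_wide _ _ sz); apply: eq_bigr => i _.
rewrite coefB coefXM coefZ coef_deriv exprS mulrA; congr (_ * _).
by case: (i : nat) => [|j] /=; rewrite mulrBr mulr_natr [_ * c]mulrC ?mulr0n.
Qed.

(** * The polynomials attached to letter sets and their recursion *)

Section StarPoly.
Variable n : nat.
Implicit Types (s : 'S_n) (A B : {set 'I_n}).

(** This is [P] with [d = #|A|.-1]. Using [chi / (x - 1)] raises the exponent [d - 1] to [d], which
    stays natural when [d = 0]. *)
Definition star_poly A s : {poly rat} :=
  (#|A|`!%:R)^-1 *: (('X - 1) ^+ #|A|.-1 * cyc_quot A s).

(** The left side is the [t]-derivative of [x^(-d) P], that is, removal of the first letter [i]. On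
    the right, either [i] occurs again and the letter set stays [A], or it does not, and then
    [(i z) s] must fix [i], so [i = s z]. The factor ['X] compensates the drop of [d] by one. *)
Lemma star_poly_rec A s z : perm_stable A s -> z \in A ->
  'X * (star_poly A s)^`() - #|A|.-1%:R *: star_poly A s =
    \sum_(i in A | i != z) star_poly A (tperm i z * s)
    + 'X * (if s z == z then 0 else star_poly (A :\ s z) (tperm (s z) z * s)).
Proof.
move=> sA zA.
have E := sum_cyc_quot_tperm sA zA.
have cA1 : #|A| = #|A|.-1.+1 by rewrite prednK // (cardD1 z) zA.
rewrite /star_poly -scaler_sumr -mulr_sumr.
set k := cyc_quot A s in E *; set S := \sum_(i in A | i != z) _ in E *.
set d := #|A|.-1 in cA1 E *; rewrite cA1 in E *.
pose k' : {poly rat} := if s z == z then 0 else cyc_quot (A :\ s z) (tperm (s z) z * s).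
rewrite -/k' in E.
apply: (mulfI polyX1_neq0);
  rewrite derivZ derivM deriv_exp derivB derivX -polyC1 derivC polyC1.
set a := (d.+1`!%:R : rat)^-1.
(* The deleted term is put over the common factorial, [1 / d! = (d + 1) / (d + 1)!], and the extra
   ['X - 1] restores the exponent [d]. Here [d > 0] because [z] survives the deletion. *)
have Ek' : ('X - 1) * (if s z == z then 0 else (#|A :\ s z|`!%:R : rat)^-1 *:
     (('X - 1) ^+ #|A :\ s z|.-1 * cyc_quot (A :\ s z) (tperm (s z) z * s)))
   = a *: (d.+1%:R * ('X - 1) ^+ d * k').
  rewrite /k'; case: eqVneq => [sz|sz]; first by rewrite !mulr0 scaler0.
  have szA : s z \in A by rewrite sA.
  have cD : #|A :\ s z| = d.
    by move: cA1; rewrite (cardsD1 (s z) A) szA add1n => -[].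
  have d0 : (0 < d)%N by rewrite -cD; apply/card_gt0P; exists z;
    rewrite !inE eq_sym sz.
  have Ea : (d`!%:R : rat)^-1 = a * d.+1%:R.
    by rewrite /a factS natrM invfM mulrAC mulVf ?mul1r // Num.Theory.pnatr_eq0.
  have -> : ('X - 1) ^+ d = ('X - 1) * ('X - 1) ^+ d.-1 :> {poly rat}.
    by rewrite -exprS prednK.
  rewrite cD Ea -!mul_polyC polyCM polyC_natr; ring.
(* For [d = 0] the truncated exponent [d.-1] is harmless, as the term has multiplicity 0. *)
have Ed : ('X - 1) * ((1 - 0) * ('X - 1) ^+ d.-1 *+ d) = d%:R * ('X - 1) ^+ d :> {poly rat}.
  by case: (d) => [|e];
    rewrite ?mulr0n ?mulr0 ?mul0r // subr0 mul1r -mulr_natl mulrCA -exprS.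
rewrite [RHS]mulrDr [('X - 1) * ('X * _)]mulrCA Ek'.
rewrite -!mul_polyC.
transitivity (a%:P * ('X - 1) ^+ d * (('X - 1) * S + 'X * d.+1%:R * k'));
  last by ring.
rewrite E polyC_natr.
transitivity (a%:P * 'X * (('X - 1) * ((1 - 0) * ('X - 1) ^+ d.-1 *+ d)) * k
  + a%:P * ('X - 1) ^+ d * ('X - 1) * ('X * k^`() - d%:R * k));
    last by rewrite Ed; ring.
set w := (_ *+ d); ring.
Qed.

End StarPoly.

(** * Coefficients of the powers of the Jucys-Murphy element *)

Lemma galg_coef_sum (R : comNzRingType) (gT : finGroupType) (I : Type)
    (r : seq I) (P : pred I) (F : I -> group_alg R gT) g :
  galg_coef (\sum_(i <- r | P i) F i) g = \sum_(i <- r | P i) galg_coef (F i) g.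
Proof. by rewrite /galg_coef sum_ffunE. Qed.

Lemma galg_coef_eltM (R : comNzRingType) (gT : finGroupType) (h g : gT)
    (x : group_alg R gT) :
  galg_coef (galg_elt R h * x) g = galg_coef x (h^-1 * g)%g.
Proof.
rewrite /galg_coef ffunE (bigD1 h) //= big1 ?addr0 => [|k kh].
  by rewrite /galg_coef ffunE eqxx mul1r.
by rewrite /galg_coef ffunE (negPf kh) mul0r.
Qed.

Lemma galg_coef_jmM n (x : 'QS_n.+1) s :
  galg_coef (jucys_murphy n * x) s
  = \sum_(i | i != ord_max) galg_coef x (tperm i ord_max * s)%g.
Proof.
rewrite mulr_suml galg_coef_sum [RHS]big_mkcond (@bigD1_ord _ _ _ _ ord_max) //=.
rewrite eqxx add0r; apply: eq_bigr => i _.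
by rewrite galg_coef_eltM tpermV eq_sym neq_lift.
Qed.

Section StarCount.
Variable n : nat.
Implicit Types (s : 'S_n) (A B : {set 'I_n}).

Lemma perm_on_stable A s : perm_on A s -> perm_stable A s.
Proof. by move=> sA i; apply: perm_closed. Qed.

Lemma perm_on_tperm A s i z : i \in A -> z \in A ->
  perm_on A (tperm i z * s)%g = perm_on A s.
Proof.
move=> iA zA.
have tA : perm_on A (tperm i z).
  by apply/subsetP => j; rewrite inE; case: tpermP => [->|->|];
    rewrite ?iA ?zA ?eqxx.
apply/idP/idP => [H|H]; last exact: perm_onM.
by rewrite -(mulKg (tperm i z) s) tpermV perm_onM.
Qed.

(** The product sends [i] to [s z], so it is supported away from [i] exactly when [s z = i]. *)
Lemma perm_onD1_tperm B s i z : i \in B -> z \in B -> i != z ->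
  perm_on (B :\ i) (tperm i z * s)%g = perm_on B s && (s z == i).
Proof.
move=> iB zB iz; rewrite -(perm_on_tperm s iB zB).
have <- : (tperm i z * s)%g i = s z by rewrite permM tpermL.
set t := (tperm i z * s)%g.
apply/idP/andP => [H|[H /eqP ti]].
  split; first by apply: subset_trans H (subsetDl _ _).
  by apply: contraT => ti; move/subsetP/(_ i): H;
    rewrite !inE ti eqxx => /(_ isT).
apply/subsetP => j; rewrite !inE => tj; rewrite (subsetP H) ?inE // andbT.
by apply: contraNneq tj => ->; rewrite ti.
Qed.

(** The term of [A] is the claimed number of words of length [r] whose letters together with [z]
    make up [A]; such a word moves only points of [A], hence the condition [perm_on A s]. *)
Definition star_count z r s : rat :=
  \sum_(A : {set 'I_n} | (z \in A) && perm_on A s)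
     expo_moment #|A|.-1%:R r (star_poly A s).

Lemma cyc_quot1 s z : s z = z -> cyc_quot [set z] s = 1.
Proof.
move=> sz; rewrite /cyc_quot -(porbit_fixed sz) cyc_det_porbit porbit_fixed //.
rewrite cards1 expr1 divpp ?polyX1_neq0 //.
Qed.

(** The moment of order 0 is the value at 1, where the power of ['X - 1] vanishes unless [A =
    [set z]]; a permutation supported on one point is the identity. *)
Lemma star_count0 z s : star_count z 0 s = (s == 1%g)%:R.
Proof.
have E A : z \in A -> A != [set z] -> expo_moment #|A|.-1%:R 0 (star_poly A s) = 0.
  move=> zA Az; rewrite expo_moment0 /star_poly hornerZ hornerM horner_exp.
  rewrite hornerD hornerX hornerN hornerC subrr expr0n.
  have -> : (#|A|.-1 == 0%N) = false.
    apply: contraNF Az; rewrite (cardsD1 z A) zA /= cards_eq0 => /eqP A0.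
    by rewrite -(setD1K zA) A0 setU0.
  by rewrite mul0r mulr0.
rewrite /star_count; have [s1|s1] := eqVneq s 1%g.
  rewrite (bigD1 [set z]) /=; last by rewrite set11 s1 perm_on1.
  rewrite [X in _ + X]big1 ?addr0 => [|A /andP[/andP[zA _] Az]]; last exact: E.
  rewrite expo_moment0 /star_poly cyc_quot1 ?s1 ?perm1 // cards1.
  by rewrite expr0 mulr1 invr1 scale1r hornerC.
rewrite big1 // => A /andP[zA sA]; apply: E => //; apply: contraNneq s1 => Az.
by rewrite Az in sA; apply/eqP; apply: perm_on_id sA _; rewrite cards1.
Qed.

Lemma star_countS z r s :
  star_count z r.+1 s = \sum_(i | i != z) star_count z r (tperm i z * s)%g.
Proof.
pose F i A := expo_moment #|A|.-1%:R r (star_poly A (tperm i z * s)%g).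
(* The sets for [(i z) s] are split by whether they contain [i], and both halves are rewritten as
   sums over the same sets [A] supporting [s]. *)
have S1 i : i != z -> star_count z r (tperm i z * s)%g =
    \sum_(A : {set 'I_n} | (z \in A) && perm_on A s) (if i \in A then F i A else 0)
  + \sum_(A : {set 'I_n} | (z \in A) && perm_on A s)
       (if (i \in A) && (s z == i) then F i (A :\ i) else 0).
  move=> iz; rewrite /star_count (bigID (fun A : {set _} => i \in A)) /=;
    congr (_ + _).
    rewrite -big_mkcondr; apply: eq_bigl => A.
    by case zA: (z \in A); case iA: (i \in A); rewrite ?andbF //= perm_on_tperm.
  rewrite -big_mkcondr.
  (* A set that misses [i] is written as [B :\ i] with [i] in [B]. *)
  rewrite (reindex_onto (fun B : {set 'I_n} => B :\ i) (fun A => i |: A)) /=;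
    last first.
    by move=> A /andP[_ iA]; rewrite setU1K.
  apply: eq_big => [B|//].
  rewrite !inE eqxx /= andbT eq_sym (negPf iz) /=.
  have [iB|iB] := boolP (i \in B); last first.
    have -> : (i |: B :\ i == B) = false.
      by apply: contraNF iB => /eqP <-; rewrite !inE eqxx.
    by rewrite !andbF.
  rewrite setD1K // eqxx andbT; case zB: (z \in B) => //=.
  by rewrite perm_onD1_tperm.
rewrite [RHS](eq_bigr _ S1) big_split /=.
rewrite [X in _ = X + _]exchange_big [X in _ = _ + X]exchange_big /=.
rewrite -big_split /=; apply: eq_bigr => A /andP[zA sA].
have st := perm_on_stable sA.
rewrite expo_momentS (star_poly_rec st zA) linearD linear_sum /=; congr (_ + _).
  by rewrite -big_mkcondr; apply: eq_bigl => i; rewrite andbC.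
have [sz|sz] := eqVneq (s z) z.
  rewrite mulr0 linear0 big1 // => i iz.
  by rewrite sz eq_sym (negPf iz) andbF.
have szA : s z \in A by rewrite st.
(* Only the letter [i = s z] can disappear. Then [#|A|.-1] drops by one, which [expo_momentMX]
   matches with the factor ['X]. *)
rewrite (bigD1 (s z)) //= szA eqxx big1 ?addr0 => [|i /andP[_ /negPf isz]].
  rewrite /F; have -> : #|A|.-1 = #|A :\ s z|.-1.+1.
    rewrite (cardsD1 (s z)) szA prednK //.
    by apply/card_gt0P; exists z; rewrite !inE eq_sym sz.
  by rewrite -natr1 expo_momentMX.
by rewrite eq_sym isz andbF.
Qed.

End StarCount.

Lemma galg_coef_jmX n r (s : 'S_n.+1) :
  galg_coef (jucys_murphy n ^+ r) s = star_count ord_max r s.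
Proof.
elim: r s => [|r IH] s; first by rewrite expr0 star_count0 /galg_coef ffunE.
by rewrite exprS galg_coef_jmM star_countS; apply: eq_bigr => i _; rewrite IH.
Qed.

(** * From permutations fixing the last point to permutations of [n] points *)

Section CondExp.
Variable n : nat.
Implicit Types (t : 'S_n) (D : {set 'I_n}).

Local Notation lift_max t := (lift_perm ord_max ord_max t).
Local Notation lift_set D := (lift ord_max @: D).

Lemma perm_restr_lift t : perm_restr (lift_max t) = t.
Proof.
apply/permP => i; apply: (@lift_inj _ ord_max).
by rewrite perm_restrE ?lift_perm_id // lift_perm_lift.
Qed.

Lemma lift_perm_restr (s : 'S_n.+1) : s ord_max = ord_max ->
  lift_max (perm_restr s) = s.
Proof.
move=> s_max; apply/permP => i; case: (unliftP ord_max i) => [j|] ->.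
  by rewrite lift_perm_lift perm_restrE.
by rewrite lift_perm_id.
Qed.

Lemma galg_coef_cond_exp (x : 'QS_n.+1) t :
  galg_coef (cond_exp x) t = galg_coef x (lift_max t).
Proof.
rewrite galg_coef_sum (bigD1 (lift_max t)) ?lift_perm_id //=.
rewrite big1 ?addr0 => [|s /andP[/eqP s_max st]].
  by rewrite perm_restr_lift /galg_coef !ffunE eqxx; exact: mulr1.
have /negPf tN : t != perm_restr s.
  by apply: contraNneq st => ->; rewrite lift_perm_restr.
by rewrite /galg_coef !ffunE tN; exact: mulr0.
Qed.

Lemma cyc_det_lift D t : cyc_det (lift_set D) (lift_max t) = cyc_det D t.
Proof.
have maxN : ord_max \notin lift_set D.
  by apply/imsetP => -[i _ /eqP]; rewrite (negPf (neq_lift _ _)).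
rewrite /cyc_det (expand_det_row _ ord_max) (bigD1 ord_max) //= big1 => [|j jm].
  rewrite mxE (negPf maxN) eqxx mul1r addr0 /cofactor.
  rewrite -signr_odd addnn odd_double expr0 mul1r; congr (\det _).
  apply/matrixP => i j; rewrite !mxE lift_perm_lift !(inj_eq lift_inj).
  by rewrite mem_imset //; apply: lift_inj.
by rewrite mxE (negPf maxN) eq_sym (negPf jm) mul0r.
Qed.

(** The fixed point [ord_max] contributes exactly the factor ['X - 1] removed by the quotient. *)
Lemma cyc_quot_lift D t : cyc_quot (ord_max |: lift_set D) (lift_max t) = cyc_det D t.
Proof.
have maxN : ord_max \notin lift_set D.
  by apply/imsetP => -[i _ /eqP]; rewrite (negPf (neq_lift _ _)).
rewrite /cyc_quot (@cyc_det_fixed _ _ _ ord_max) ?lift_perm_id ?setU11 //.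
rewrite setU1K // cyc_det_lift mulKp ?polyX1_neq0 //.
Qed.

Lemma perm_on_lift D t : perm_on (ord_max |: lift_set D) (lift_max t) = perm_on D t.
Proof.
apply/subsetP/subsetP => H i.
  rewrite inE => ti; have := H (lift ord_max i).
  rewrite !inE lift_perm_lift (inj_eq lift_inj) => /(_ ti).
  by rewrite eq_sym (negPf (neq_lift _ _)) /= mem_imset //; apply: lift_inj.
case: (unliftP ord_max i) => [j|] ->; rewrite !inE ?eqxx //.
rewrite lift_perm_lift (inj_eq lift_inj) => tj.
by rewrite mem_imset ?H ?orbT //; apply: lift_inj.
Qed.

(** The form of [star_poly] for a lifted permutation: [d] is the size of the set without [ord_max],
    and [p] is the characteristic polynomial on it. *)
Definition moment_poly (d : nat) (p : {poly rat}) : {poly rat} :=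
  (d.+1`!%:R)^-1 *: (('X - 1) ^+ d * p).

Lemma galg_coef_jm_moment r t :
  galg_coef (jm_moment n r) t =
    \sum_(D : {set 'I_n} | perm_on D t)
       expo_moment #|D|%:R r (moment_poly #|D| (cyc_det D t)).
Proof.
rewrite galg_coef_cond_exp galg_coef_jmX /star_count.
(* Sets containing [ord_max] correspond to arbitrary subsets [D] of the first [n] points. *)
rewrite (reindex_onto (fun D : {set 'I_n} => ord_max |: lift_set D)
           (fun A : {set 'I_n.+1} => lift ord_max @^-1: A)) /=; last first.
  move=> A /andP[mA _]; apply/setP => i; rewrite !inE.
  case: (unliftP ord_max i) => [j|] ->; last by rewrite eqxx mA.
  rewrite eq_sym (negPf (neq_lift _ _)) /= mem_imset ?inE //; exact: lift_inj.
apply: eq_big => D.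
  rewrite setU11 perm_on_lift /=; case: perm_on => //=; apply/eqP/setP => i.
  rewrite !inE eq_sym (negPf (neq_lift _ _)) /= mem_imset //; exact: lift_inj.
have maxN : ord_max \notin lift_set D.
  by apply/imsetP => -[i _ /eqP]; rewrite (negPf (neq_lift _ _)).
rewrite /star_poly cyc_quot_lift cardsU1 maxN card_imset //; exact: lift_inj.
Qed.

End CondExp.

(** * Exponential generating functions *)

Implicit Types u v w : pseries.

Lemma eq_ps_mul u u' v v' : u =1 u' -> v =1 v' -> ps_mul u v =1 ps_mul u' v'.
Proof. by move=> uu vv k; apply: eq_bigr => i _; rewrite uu vv. Qed.

(** Truncation to polynomials, through which associativity of the series product is inherited. *)
Lemma ps_mul_coefE K u v k : (k < K)%N ->
  ps_mul u v k = ((\poly_(i < K) u i) * (\poly_(i < K) v i))`_k.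
Proof.
move=> kK; rewrite coefM; apply: eq_bigr => i _; rewrite !coef_poly.
by rewrite !ifT //; have := ltn_ord i; lia.
Qed.

Lemma ps_mulA u v w : ps_mul u (ps_mul v w) =1 ps_mul (ps_mul u v) w.
Proof.
move=> k; pose T (x : pseries) := \poly_(i < k.+1) x i.
transitivity ((T u * (T v * T w))`_k); last rewrite mulrA.
  rewrite coefM; apply: eq_bigr => i _; rewrite coef_poly ltn_ord.
  by rewrite (@ps_mul_coefE k.+1) //; have := ltn_ord i; lia.
rewrite coefM; apply: eq_bigr => i _; rewrite [(T w)`_ _]coef_poly.
rewrite ifT; last by have := ltn_ord i; lia.
by rewrite (@ps_mul_coefE k.+1).
Qed.

Lemma ps_mul1l u : ps_mul ps_one u =1 u.
Proof.
move=> k; rewrite /ps_mul big_ord_recl big1 => [|i _]; last by rewrite mul0r.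
by rewrite mul1r addr0 subn0.
Qed.

Lemma ps_mulZr a u v : ps_mul u (fun k => a * v k) =1 fun k => a * ps_mul u v k.
Proof. by move=> k; rewrite mulr_sumr; apply: eq_bigr => i _;
  rewrite mulrCA. Qed.

Definition ps_mulX u : pseries := fun k => if k is k'.+1 then u k' else 0.

Lemma ps_mulXl u v : ps_mul (ps_mulX u) v =1 ps_mulX (ps_mul u v).
Proof.
case=> [|k]; first by rewrite /ps_mul big_ord1 mul0r.
by rewrite /ps_mul big_ord_recl mul0r add0r.
Qed.

Lemma ps_mulXr u v : ps_mul u (ps_mulX v) =1 ps_mulX (ps_mul u v).
Proof.
case=> [|k]; first by rewrite /ps_mul big_ord1 mulr0.
rewrite /ps_mul big_ord_recr /= subnn mulr0 addr0; apply: eq_bigr => i _.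
by rewrite subSn // -ltnS.
Qed.

Lemma eq_ps_mulX u v : u =1 v -> ps_mulX u =1 ps_mulX v.
Proof. by move=> uv [|k] /=. Qed.

Lemma ps_mulXZ a u : ps_mulX (fun k => a * u k) =1 fun k => a * ps_mulX u k.
Proof. by case=> [|k] /=; rewrite ?mulr0. Qed.

Lemma iter_ps_mulXr m u v :
  ps_mul u (iter m ps_mulX v) =1 iter m ps_mulX (ps_mul u v).
Proof.
elim: m => //= m IH k; rewrite ps_mulXr; exact: eq_ps_mulX.
Qed.

Lemma iter_ps_mulXE m u k : iter m ps_mulX u k = ps_coef (k%:Z - m%:Z) u.
Proof.
elim: m k => [|m IH] k; first by rewrite subr0.
case: k => [//|k]; rewrite iterS [LHS]IH; congr (ps_coef _ _); lia.
Qed.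

(** The power series in [t] of [x^(-c) p(x)] at [x = e^t]. *)
Definition expo_egf c p : pseries := fun k => expo_moment c k p / k`!%:R.

(** Shifting [c] by [e] multiplies the series by [e^(-e t)]; on coefficients this is the binomial
    theorem. *)
Lemma expo_egfD c e p :
  expo_egf (c + e) p =1 ps_mul (fun j => (- e) ^+ j / j`!%:R) (expo_egf c p).
Proof.
move=> k; rewrite /expo_egf /ps_mul {1}/expo_moment mulr_suml.
under [RHS]eq_bigr do rewrite /expo_moment mulr_suml mulr_sumr.
rewrite exchange_big; apply: eq_bigr => i _ /=.
rewrite opprD addrA exprDn mulr_sumr mulr_suml; apply: eq_bigr => j _ /=.
have jk : (j <= k)%N by rewrite -ltnS.
have f0 m : (m`!%:R : rat) != 0 by rewrite Num.Theory.pnatr_eq0 -lt0n fact_gt0.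
rewrite -(bin_fact jk) -mulr_natr !natrM; field.
by rewrite !f0 Num.Theory.pnatr_eq0 -lt0n bin_gt0 jk.
Qed.

(** The factor [x^(-m/2) (x^m - 1)] is [e^(m t/2) - e^(-m t/2) = m t f(m t)]. *)
Lemma expo_egfMXn1 c m p :
  expo_egf (c + m%:R / 2) (('X^m - 1) * p) =1
    fun k => m%:R * ps_mulX (ps_mul (ps_dilate m%:R ps_f) (expo_egf c p)) k.
Proof.
move=> k; rewrite -ps_mulXl -[RHS]mulrC.
transitivity (ps_mul (fun j => ((m%:R / 2) ^+ j - (- (m%:R / 2)) ^+ j) / j`!%:R)
  (expo_egf c p) k).
  have E1 := expo_egfD c (- (m%:R / 2)) p k;
    have E2 := expo_egfD c (m%:R / 2) p k.
  transitivity (expo_egf (c - m%:R / 2) p k - expo_egf (c + m%:R / 2) p k).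
    rewrite /expo_egf mulrBl mul1r linearB /= mulrBl.
    have -> : c + m%:R / 2 = c - m%:R / 2 + m%:R by field.
    by rewrite expo_momentMXn; congr (_ - expo_moment _ _ _ / _); field.
  rewrite E1 E2 -sumrB; apply: eq_bigr => j _.
  by rewrite opprK -mulrBl -mulrBl.
(* The constant term of the difference of exponentials is 0; the others match the shifted index in
   [ps_f]. *)
rewrite /ps_mul mulr_suml; apply: eq_bigr => -[[|j] jk] _ /=.
  by rewrite !expr0 subrr !mul0r.
rewrite /ps_dilate /ps_f /ps_dilate /ps_sinh.
have f0 : (j.+1`!%:R : rat) != 0 by rewrite Num.Theory.pnatr_eq0 -lt0n fact_gt0.
rewrite [(- (m%:R / 2)) ^+ _]exprNn !expr_div_n expr1n [m%:R ^+ j.+1]exprS.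
have : (2 : rat) ^+ j.+1 != 0 by rewrite expf_neq0.
move: (2 ^+ j.+1) ((-1) ^+ j.+1) (j.+1`!%:R) f0 => x y f f0 x0.
by field; rewrite f0 x0.
Qed.

Lemma expo_egf1 : expo_egf 0 1 =1 ps_one.
Proof.
move=> k; rewrite /expo_egf /expo_moment size_poly1 big_ord1 coef1 subr0 mul1r expr0n.
by case: k => [|k]; rewrite ?fact0 ?divr1 // mul0r.
Qed.

(** The total shift is shared out among the factors, [p / 2] for each ['X^p - 1]; each factor also
    yields one power of [t]. *)
Lemma expo_egf_prod (l : seq nat) :
  expo_egf ((sumn l)%:R / 2) (\prod_(p <- l) ('X^p - 1)) =1
    fun k => (\prod_(p <- l) p%:R)
      * iter (size l) ps_mulX (\big[ps_mul/ps_one]_(p <- l) ps_dilate p%:R ps_f) k.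
Proof.
elim: l => [|p l IH] k; first by rewrite !big_nil mul0r mul1r expo_egf1.
rewrite !big_cons /= natrD mulrDl addrC expo_egfMXn1 -mulrA; congr (_ * _).
rewrite (eq_ps_mulX (eq_ps_mul (frefl _) IH)).
rewrite (eq_ps_mulX (ps_mulZr _ _ _)) ps_mulXZ; congr (_ * _).
exact/eq_ps_mulX/iter_ps_mulXr.
Qed.

Lemma ps_big_nseq d (l : seq nat) :
  \big[ps_mul/ps_one]_(p <- nseq d 1%N ++ l) ps_dilate p%:R ps_f =1
  ps_mul (ps_exp ps_f d) (\big[ps_mul/ps_one]_(p <- l) ps_dilate p%:R ps_f).
Proof.
elim: d => [|d IH] k /=; first by rewrite ps_mul1l.
rewrite big_cons /= -ps_mulA; apply: eq_ps_mul IH _ => j.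
by rewrite /ps_dilate expr1n mul1r.
Qed.

(** The power [('X - 1) ^+ d] counts as [d] further parts equal to 1. The parts then sum to [2 d],
    whose half is the required shift [d], and the extra parts give [f(t)^d] and [t^d]. *)
Lemma moment_poly_coef r (la : seq nat) :
  expo_moment (sumn la)%:R r (moment_poly (sumn la) (\prod_(p <- la) ('X^p - 1))) =
    r`!%:R / (sumn la).+1`!%:R * (\prod_(p <- la) p%:R)
        * ps_coef (r%:Z - (sumn la + size la)%:Z)
            (ps_mul (ps_exp ps_f (sumn la))
                    (\big[ps_mul/ps_one]_(p <- la) ps_dilate p%:R ps_f)).
Proof.
set d := sumn la; have := expo_egf_prod (nseq d 1%N ++ la) r.
rewrite !big_cat /= !big_nseq sumn_cat sumn_nseq mul1n size_cat size_nseq -/d.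
rewrite iter_ps_mulXE expr1 iter_mulr_1 [iter d ( *%R 1) 1]iter_mulr_1 expr1n mul1r.
have -> : (d + d)%:R / 2 = d%:R :> rat by rewrite natrD; field.
rewrite /expo_egf /moment_poly linearZ /=.
set M := expo_moment _ _ _; have f0 : (r`!%:R : rat) != 0.
  by rewrite Num.Theory.pnatr_eq0 -lt0n fact_gt0.
move/(congr1 (fun x => x * r`!%:R)); rewrite divfK // => ->.
have -> : ps_coef (r%:Z - (d + size la)%:Z)
   (\big[ps_mul/ps_one]_(p <- nseq d 1%N ++ la) ps_dilate p%:R ps_f)
   = ps_coef (r%:Z - (d + size la)%:Z) (ps_mul (ps_exp ps_f d)
       (\big[ps_mul/ps_one]_(p <- la) ps_dilate p%:R ps_f)).
  by rewrite /ps_coef; case: (_ - _) => // k; rewrite ps_big_nseq.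
ring.
Qed.

(** * Cycle types *)

Section CycleType.
Variable n : nat.
Implicit Types (t : 'S_n) (D C : {set 'I_n}).

Lemma leq_card_set_ord D : (#|D| <= n)%N.
Proof. by have := max_card (mem D); rewrite card_ord. Qed.

Definition cycle_sizes (s : seq {set 'I_n}) := [seq #|C| | C : {set 'I_n} <- s].

Definition cycle_type_on t D : seq nat :=
  sort geq (cycle_sizes [seq C : {set 'I_n} <- enum (porbits t) | C \subset D]).

Let geq_total : total geq.
Proof. by move=> a b; apply: leq_total. Qed.

Let geq_trans : transitive geq.
Proof. by move=> b a c /= ab bc; apply: leq_trans bc ab. Qed.

Let geq_anti : antisymmetric geq.
Proof. by move=> a b /=; rewrite andbC => /anti_leq. Qed.

Lemma perm_cycle_type_on t D : perm_eq (cycle_type_on t D)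
  (cycle_sizes [seq C : {set 'I_n} <- enum (porbits t) | C \subset D]).
Proof. by rewrite perm_sort. Qed.

Lemma cycle_type_onT t : cycle_type_on t setT = cycle_type t.
Proof.
congr (sort _ _); rewrite /cycle_sizes; congr (map _ _).
by apply/all_filterP/allP => C _; apply: subsetT.
Qed.

Lemma cycle_type_on_partition t D : is_partition (cycle_type_on t D).
Proof.
rewrite /is_partition sort_sorted //= mem_sort.
apply/mapP => -[C]; rewrite mem_filter mem_enum => /andP[_ /imsetP[x _ ->]] /esym/eqP.
by rewrite (negPf (card_porbit_neq0 _ _)).
Qed.

Lemma sumn_cycle_type_on t D : perm_stable D t -> sumn (cycle_type_on t D) = #|D|.
Proof.
move=> sD; rewrite (perm_sumn (perm_cycle_type_on t D)).
rewrite sumnE big_map big_filter big_enum_cond /=.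
have pP : partition [set C in porbits t | C \subset D] D.
  apply/and3P; split.
  - apply/eqP; rewrite /cover -[RHS](bigcup_porbits sD) big_filter big_enum_cond.
    by apply: eq_bigl => C; rewrite !inE.
  - apply/trivIsetP => C C'; rewrite !inE => /andP[CP _] /andP[CP' _].
    exact: porbits_disjoint CP CP'.
  rewrite inE negb_and; apply/orP; left; apply/imsetP => -[x _ /setP/(_ x)].
  by rewrite porbit_id inE.
by rewrite (card_partition pP); apply: eq_bigl => C; rewrite !inE.
Qed.

Lemma cyc_det_cycle_type t D : perm_stable D t ->
  cyc_det D t = \prod_(p <- cycle_type_on t D) ('X^p - 1).
Proof.
move=> sD; rewrite (perm_big _ (perm_cycle_type_on t D)) /= big_map big_filter.
by rewrite big_enum_cond cyc_det_prod.
Qed.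

(** Every point outside [D] is fixed, so each cycle not contained in [D] is a singleton. *)
Lemma cycle_type_split t D : perm_on D t ->
  cycle_type t = cycle_type_on t D ++ nseq (n - #|D|) 1%N.
Proof.
move=> tD; pose s1 := [seq C : {set 'I_n} <- enum (porbits t) | ~~ (C \subset D)].
have E1 : cycle_sizes s1 = nseq (size (cycle_sizes s1)) 1%N.
  apply/all_pred1P/allP => _ /mapP[C + ->].
  rewrite mem_filter mem_enum => /andP[/subsetPn[y yC yD] /imsetP[x _ EC]].
  rewrite EC in yC; have <- : porbit t y = C by rewrite EC; apply/eqP;
    rewrite eq_porbit_mem.
  have ty : t y = y by apply: out_perm tD yD.
  by rewrite porbit_fixed // cards1 /=.
have pe : perm_eq (cycle_type t) (cycle_type_on t D ++ cycle_sizes s1).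
  rewrite /cycle_type perm_sort perm_sym.
  apply: perm_trans (perm_cat (perm_cycle_type_on t D) (perm_refl _)) _.
  rewrite /cycle_sizes -map_cat; apply: perm_map; rewrite /s1.
  by rewrite (perm_filterC (fun C : {set 'I_n} => C \subset D)).
have sz : size (cycle_sizes s1) = (n - #|D|)%N.
  have := perm_sumn pe; rewrite sumn_cat E1 sumn_nseq mul1n size_nseq.
  rewrite -(cycle_type_onT t) sumn_cycle_type_on => [|i]; last by rewrite !inE.
  by rewrite (sumn_cycle_type_on (perm_on_stable tD)) cardsT card_ord; lia.
(* Both lists are sorted, as all parts on [D] are positive and the ones come last; hence a
   rearrangement is an equality. *)
rewrite E1 sz in pe; apply: (sorted_eq geq_trans geq_anti) pe;
  first exact: sort_sorted.
have := cycle_type_on_partition t D; rewrite /is_partition => /andP[srt nz].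
rewrite !(sorted_pairwise geq_trans) in srt *; rewrite pairwise_cat srt /=.
apply/andP; split.
  apply/allrelP => a b aD /nseqP[-> _] /=; rewrite lt0n.
  by apply: contraNneq nz => <-.
by elim: (n - _)%N => //= m ->; rewrite andbT; apply/allP => b /nseqP[->].
Qed.

(** On the support no cycle has length 1, so all parts 1 come from the points outside it. *)
Lemma card_support t : #|[set i | t i != i]| = (n - count_mem 1%N (cycle_type t))%N.
Proof.
set D := [set i | t i != i].
have tD : perm_on D t by apply/subsetP => i; rewrite !inE.
rewrite (cycle_type_split tD) count_cat count_nseq /= mul1n.
have -> : count_mem 1%N (cycle_type_on t D) = 0%N.
  rewrite (seq.permP (perm_cycle_type_on t D)); apply/count_memPn/mapP => -[C].
  rewrite mem_filter mem_enum => /andP[/subsetP CD /imsetP[x _ EC]] /esym/eqP/cards1P[y Cy].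
  have xC : x \in C by rewrite EC porbit_id.
  have txC : t x \in C by rewrite EC porbit_stable porbit_id.
  by have := CD x xC; rewrite inE; move: xC txC; rewrite Cy !inE => /eqP-> ->.
by rewrite add0n subKn // leq_card_set_ord.
Qed.

(** This accounts for the binomial coefficient in [a_elt]: choosing [D] amounts to choosing its
    complement, of size [n - sumn la], among the fixed points of [t], which number [n - sumn la]
    plus the parts 1 of [la]. *)
Lemma card_cycle_type_on t la : (sumn la <= n)%N ->
  #|[set D : {set 'I_n} | perm_on D t && (cycle_type_on t D == la)]| =
    ((cycle_type t == la ++ nseq (n - sumn la) 1%N) *
     'C(n - sumn la + count_mem 1%N la, count_mem 1%N la))%N.
Proof.
move=> la_n; case: eqP => [ct|ct]; last first.
  rewrite mul0n; apply/eqP; rewrite cards_eq0; apply/eqP/setP => D;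
    rewrite !inE.
  apply/negP => /andP[tD /eqP la_D]; apply: ct.
  rewrite -la_D (sumn_cycle_type_on (perm_on_stable tD)).
  exact: cycle_type_split.
rewrite mul1n; set D0 := [set i | t i != i].
have cD0 : #|~: D0| = (n - sumn la + count_mem 1%N la)%N.
  have := cardsC D0; rewrite card_ord.
  have : (count_mem 1%N (cycle_type t) <= n)%N.
    apply: leq_trans (count_size _ _) _; rewrite /cycle_type size_sort size_map.
    by rewrite -cardE (leq_trans (leq_imset_card _ _)) // card_ord.
  rewrite [X in (X + _)%N = _]card_support ct count_cat count_nseq /= mul1n.
  by move: (count_mem _ _) => m; lia.
have -> : [set D : {set 'I_n} | perm_on D t && (cycle_type_on t D == la)] =
   (@setC _) @: [set B : {set 'I_n} | B \subset ~: D0 & #|B| == (n - sumn la)%N].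
  apply/setP => D; rewrite -[D]setCK mem_imset; last exact: setC_inj.
  rewrite !inE setCK setCS.
  have <- : perm_on D t = (D0 \subset D).
    by apply: eq_subset => i; rewrite !inE.
  case tD: (perm_on D t) => //=.
  have Dn := leq_card_set_ord D.
  have := cardsC D; rewrite card_ord => cC.
  apply/eqP/eqP => [la_D|la_D].
    have := sumn_cycle_type_on (perm_on_stable tD); rewrite la_D => ->.
    by apply/eqP; rewrite -(eqn_add2l #|D|) cC subnKC.
  (* Conversely the size of [D] suffices: both decompositions of [cycle_type t] then end in equally
     many ones, which cancel. *)
  have Dla : #|D| = sumn la.
    by apply/eqP; rewrite -(eqn_add2r #|~: D|) cC la_D subnKC.
  move/eqP: ct; rewrite (cycle_type_split tD) Dla => /eqP ct.
  have /eqP := congr1 size ct; rewrite !size_cat eqn_add2r => /eqP sz.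
  by move/eqP: ct; rewrite eqseq_cat // => /andP[/eqP].
rewrite card_imset; last exact: setC_inj.
by rewrite cards_draws cD0 -bin_sub ?leq_addr // addKn.
Qed.

End CycleType.

(** * Comparison of coefficients in the group algebra *)

Lemma galg_coef_a_elt n la (t : 'S_n) :
  galg_coef (a_elt la n) t =
    'C(n - sumn la + count_mem 1%N la, count_mem 1%N la)%:R
     * (cycle_type t == la ++ nseq (n - sumn la) 1%N)%:R.
Proof.
rewrite /a_elt {1}/galg_coef ffunE; congr (_ * _).
rewrite -[LHS]/(galg_coef (class_sum n _) t) galg_coef_sum.
case: eqVneq => [ct|ct].
  rewrite (bigD1 t) ?ct //= big1 => [|s /andP[_ st]].
    by rewrite /galg_coef ffunE eqxx addr0.
  by rewrite /galg_coef ffunE eq_sym (negPf st).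
rewrite big1 // => s /eqP cs; rewrite /galg_coef ffunE.
by case: eqP => // E; move: ct; rewrite E cs eqxx.
Qed.

Theorem theorem3 (n r : nat) (hn : (1 <= n)%N) :
  jm_moment n r =
    \sum_(la <- partitions_leq n)
      (r`!%:R / (sumn la).+1`!%:R * (\prod_(p <- la) p%:R)
        * ps_coef (r%:Z - (sumn la + size la)%:Z)
            (ps_mul (ps_exp ps_f (sumn la))
                    (\big[ps_mul/ps_one]_(p <- la) ps_dilate p%:R ps_f)))
      *: a_elt la n.
Proof.
apply/ffunP => t; rewrite -[LHS]/(galg_coef _ t) -[RHS]/(galg_coef _ t).
rewrite galg_coef_jm_moment galg_coef_sum.
pose g la := expo_moment (sumn la)%:R r
  (moment_poly (sumn la) (\prod_(p <- la) ('X^p - 1))).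
(* The contribution of [D] depends only on the cycle type of [t] on [D]. Grouping the sets by this
   type leaves, for each [la], the number of such [D], which is the coefficient of [t] in
   [a_elt la n]. *)
transitivity (\sum_(D | perm_on D t) \sum_(la <- partitions_leq n)
    (if cycle_type_on t D == la then g la else 0)).
  apply: eq_bigr => D tD; have st := perm_on_stable tD.
  have sD := sumn_cycle_type_on st.
  rewrite (bigD1_seq (cycle_type_on t D)) ?partitions_leq_uniq //=; last first.
    rewrite mem_partitions_leq cycle_type_on_partition sD.
    exact: leq_card_set_ord.
  rewrite eqxx big1 ?addr0 => [|la laD]; last by rewrite eq_sym (negPf laD).
  by rewrite /g sD -cyc_det_cycle_type.
rewrite exchange_big; apply: eq_big_seq => la.
rewrite mem_partitions_leq => /andP[_ la_n].
rewrite /galg_coef ffunE -[RHS]/(_ * galg_coef (a_elt la n) t) galg_coef_a_elt.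
rewrite -moment_poly_coef -/(g la) -big_mkcondr /=.
transitivity (\sum_(D in [set D | perm_on D t && (cycle_type_on t D == la)]) g la).
  by apply: eq_bigl => D; rewrite inE.
by rewrite sumr_const card_cycle_type_on // -[LHS]mulr_natr natrM [in RHS](mulrC _%:R).
Qed.
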